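(* Let $c\in\mathbb{R}-\{0\}$ and consider $\pi_1$ under the measure $\mathcal{P}_n^{(1+\frac cn)}$ (for $n>|c|$). Then, as $n\to\infty$, $\frac{\pi_1}{n}$ converges in distribution to the distribution on $[0,1]$ with distribution function $$F_c(x)=\begin{cases}x+\frac1c(e^{cx}-1)\log\frac{1-e^{-c}}{1-e^{-cx}},\ x\in[0,1],& \text{if } c>0;\\[4pt] x+\frac1{|c|}(1-e^{-|c|x})\log\frac{e^{|c|}-1}{e^{|c|x}-1},\ x\in[0,1],& \text{if } c<0,\end{cases}$$ (where the value at $x=0$ is understood as the limit as $x\to0^+$, namely $F_c(0)=0$), and monotone decreasing density function $$f_c(x)=\begin{cases}e^{cx}\log\frac{1-e^{-c}}{1-e^{-cx}},\ x\in(0,1],& \text{if } c>0;\\[4pt] e^{-|c|x}\log\frac{e^{|c|}-1}{e^{|c|x}-1},\ x\in(0,1],& \text{if } c<0.\end{cases}$$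
   Context: Write $[n]=\{1,\ldots,n\}$ and let $S_n$ be the set of permutations of $[n]$, written in one-line notation $\sigma=\sigma_1\cdots\sigma_n$; $\sigma^{-1}_k$ is the position of $k$ in $\sigma$. A parking function of length $n$ is a sequence $\pi=(\pi_1,\ldots,\pi_n)\in[n]^n$ with $|\{i:\pi_i\le j\}|\ge j$ for all $j\in[n]$; $PF_n$ is the set of these. The inversion statistic is $I_n(\sigma)=\sum_{1\le i<j\le n}1_{\sigma_j<\sigma_i}$. For $j\in[n]$ let $I_{n,<j}(\sigma)=\sum_{1\le i<j}1_{\sigma^{-1}_j<\sigma^{-1}_i}$ (the number of inversions of $\sigma$ involving $j$ and a number less than $j$) and $\tilde I_{n,<j}=I_{n,<j}+1$. For $q\in(0,\infty)$, the Mallows measure on $S_n$ is $P_n^{(q)}(\sigma)=q^{I_n(\sigma)}/K_n$, where $K_n=\sum_{\rho\in S_n}q^{I_n(\rho)}$ is the normalizing constant; $P_n$ denotes the uniform measure on $S_n$. The map $(\sigma,\tau)\mapsto(\tilde I_{n,<\tau_1}(\sigma),\ldots,\tilde I_{n,<\tau_n}(\sigma))$ sends $S_n\times S_n$ into $PF_n$, and $\mathcal{P}_n^{(q)}$ denotes the probability measure on $PF_n$ that is the image of $P_n^{(q)}\times P_n$ under this map. $\pi_1$ denotes the first coordinate of the random parking function $\pi=(\pi_1,\ldots,\pi_n)\in PF_n$ (the dependence on $n$ is suppressed). *)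

(* Defs.v *)
From HB Require Import structures.
From mathcomp Require Import all_boot all_order all_algebra all_fingroup.
From mathcomp Require Import all_classical all_reals all_analysis.

Set Implicit Arguments.
Unset Strict Implicit.
Unset Printing Implicit Defensive.

Import Order.TTheory GRing.Theory Num.Theory.
Import numFieldNormedType.Exports.

Local Open Scope classical_set_scope.
Local Open Scope ring_scope.

(* Positions and letters are 0-based: i : 'I_n stands for i + 1 in [n], and a
   permutation of [n] is s : 'S_n. The values of parking functions are not
   shifted: they are naturals in {1, ..., n}. *)

Section combinatorics.
Local Open Scope nat_scope.
Variable n : nat.

Definition inversions (s : 'S_n) : nat :=
  \sum_(i < n) \sum_(j < n | i < j) (s j < s i).

(* Inversions of s involving j and a smaller letter; s^-1 j is the position
   of j. *)
Definition inversions_lt (s : 'S_n) (j : 'I_n) : nat :=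
  \sum_(i < n | i < j) ((s^-1)%g j < (s^-1)%g i).

Definition inversions_lt1 (s : 'S_n) (j : 'I_n) : nat := inversions_lt s j + 1.

Definition is_parking (p : {ffun 'I_n -> nat}) : bool :=
  [forall i, 1 <= p i <= n] &&
  [forall j : 'I_n, j.+1 <= #|[pred i | p i <= j.+1]|].

Definition parking : Type := {p : {ffun 'I_n -> nat} | is_parking p}.

Lemma inversions_lt_le (s : 'S_n) (j : 'I_n) : inversions_lt s j <= j.
Proof.
rewrite /inversions_lt.
apply: (@leq_trans (\sum_(i < n | i < j) 1)).
  by apply: leq_sum => i _; case: (_ < _).
rewrite (big_ord_narrow (ltnW (ltn_ord j))) /=.
by rewrite sum_nat_const card_ord muln1.
Qed.

Lemma parking_mapP (st : 'S_n * 'S_n) :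
  is_parking [ffun i => inversions_lt1 st.1 (st.2 i)].
Proof.
case: st => s t /=; apply/andP; split.
  apply/forallP => i; rewrite ffunE /inversions_lt1 /= addn1.
  exact: leq_ltn_trans (inversions_lt_le s (t i)) (ltn_ord _).
apply/forallP => j; pose f (k : 'I_j.+1) := (t^-1)%g (widen_ord (ltn_ord j) k).
have f_inj : injective f.
  by move=> x y /perm_inj /(congr1 val) /= xy; apply: val_inj.
rewrite -[X in X <= _](card_ord j.+1) -(card_codom f_inj).
apply/subset_leq_card/fintype.subsetP => _ /codomP[k ->].
rewrite inE ffunE /inversions_lt1 addn1 ltnS permKV.
by rewrite (leq_trans (inversions_lt_le _ _))//= -ltnS.
Qed.

Definition parking_map (st : 'S_n * 'S_n) : parking :=
  exist (fun p => is_parking p) _ (parking_mapP st).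

End combinatorics.

HB.instance Definition _ n := Choice.on (parking n).
HB.instance Definition _ n := isPointed.Build (parking n) (parking_map (1%g, 1%g)).
HB.instance Definition _ n := @isMeasurable.Build default_measure_display
  (parking n) discrete_measurable discrete_measurable0
  discrete_measurableC discrete_measurableU.

HB.instance Definition _ (T : finType) := isPointed.Build (perm_type T) 1%g.
HB.instance Definition _ (T : finType) :=
  @isMeasurable.Build default_measure_display
  (perm_type T) discrete_measurable discrete_measurable0
  discrete_measurableC discrete_measurableU.

Section finite_pmf.
Context {R : realType} {d : measure_display} {T : measurableType d}.
Variables (w : T -> R) (w_ge0 : forall s, 0 <= w s).
Local Open Scope ereal_scope.

Let mu (A : set T) : \bar R := \esum_(s in A) (w s)%:E.

Lemma esum_sigma_additive : semi_sigma_additive mu.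
Proof.
move=> F mF tF mUF; rewrite /mu; apply: cvg_toP.
  apply: ereal_nondecreasing_is_cvgn => a b ab.
  by apply: lee_sum_nneg_natr => // k _ _; apply: esum_ge0 => s _; rewrite lee_fin.
by rewrite nneseries_sum_bigcup// => i; rewrite lee_fin.
Qed.

End finite_pmf.

Lemma esum_setT_fin {R : realType} (T : finType) (w : T -> R) :
  (forall s, 0 <= w s) ->
  (\esum_(s in [set: T]) (w s)%:E = (\sum_s w s)%:E)%E.
Proof.
move=> w0; rewrite esum_fset//; [|exact: finite_finset|by move=> i _; rewrite lee_fin].
rewrite -sumEFin (bigfs _ (index_enum_uniq T))//.
  by rewrite (_ : [set` _] = setT)//; apply/seteqP; split.
by move=> i _; rewrite mem_index_enum.
Qed.

Section mallows.
Context {R : realType} (n : nat) (q : {posnum R}).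

Definition mallows_const : R := \sum_(r : 'S_n) q%:num ^+ inversions r.

Definition mallows_pmf (s : 'S_n) : R := q%:num ^+ inversions s / mallows_const.

Lemma mallows_const_gt0 : 0 < mallows_const.
Proof.
rewrite /mallows_const (bigD1 1%g)//= ltr_pwDl ?exprn_gt0//.
by apply: sumr_ge0 => r _; rewrite exprn_ge0.
Qed.

Lemma mallows_pmf_ge0 s : 0 <= mallows_pmf s.
Proof. by rewrite divr_ge0 ?exprn_ge0// ltW// mallows_const_gt0. Qed.

Definition mallows (A : set 'S_n) : \bar R := \esum_(s in A) (mallows_pmf s)%:E.

Let mallows0 : mallows set0 = 0%E.
Proof. by rewrite /mallows esum_set0. Qed.

Let mallows_ge0 A : (0 <= mallows A)%E.
Proof. by apply: esum_ge0 => s _; rewrite lee_fin mallows_pmf_ge0. Qed.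

HB.instance Definition _ := isMeasure.Build _ _ _ mallows
  mallows0 mallows_ge0 (esum_sigma_additive mallows_pmf_ge0).

Let mallows_setT : mallows [set: 'S_n] = 1%E.
Proof.
rewrite /mallows esum_setT_fin; last exact: mallows_pmf_ge0.
by rewrite -mulr_suml divff// gt_eqF// mallows_const_gt0.
Qed.

HB.instance Definition _ :=
  @Measure_isProbability.Build _ _ R mallows mallows_setT.

End mallows.
Arguments mallows {R} n q A.

Section uniform_perm.
Context (R : realType) (n : nat).

Definition uniform_perm (A : set 'S_n) : \bar R :=
  \esum_(s in A) ((n`!)%:R^-1)%:E.

Let pmf_ge0 (s : 'S_n) : 0 <= (n`!)%:R^-1 :> R.
Proof. by rewrite invr_ge0. Qed.

Let uniform_perm0 : uniform_perm set0 = 0%E.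
Proof. by rewrite /uniform_perm esum_set0. Qed.

Let uniform_perm_ge0 A : (0 <= uniform_perm A)%E.
Proof. by apply: esum_ge0 => s _; rewrite lee_fin (pmf_ge0 s). Qed.

HB.instance Definition _ := isMeasure.Build _ _ _ uniform_perm
  uniform_perm0 uniform_perm_ge0 (esum_sigma_additive pmf_ge0).

Let uniform_perm_setT : uniform_perm [set: 'S_n] = 1%E.
Proof.
rewrite /uniform_perm (esum_setT_fin pmf_ge0) sumr_const card_Sn.
by rewrite -[X in X%:E]mulr_natl divff// pnatr_eq0 -lt0n fact_gt0.
Qed.

HB.instance Definition _ :=
  @Measure_isProbability.Build _ _ R uniform_perm uniform_perm_setT.

End uniform_perm.
Arguments uniform_perm R n A : clear implicits.

Section parking_mallows.
Context {R : realType} (n : nat) (q : {posnum R}).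

Lemma measurable_parking_map :
  measurable_fun [set: 'S_n * 'S_n] (@parking_map n).
Proof.
move=> _ B _; rewrite setTI; apply: countable_measurable.
  move=> [s t]; rewrite (_ : [set (s, t)] = [set s] `*` [set t]).
    exact: measurableX.
  by apply/seteqP; split => -[a b] /= [-> ->].
exact: countableP.
Qed.

HB.instance Definition _ :=
  isMeasurableFun.Build _ _ _ _ (@parking_map n) measurable_parking_map.

Definition parking_mallows : probability (parking n) R :=
  distribution (mallows n q \x uniform_perm R n)%E (@parking_map n).

End parking_mallows.
Arguments parking_mallows {R} n q.

Section first_coordinate.
Context (R : realType) (n : nat).

Definition parking_fst (p : parking n.+1) : nat := val p ord0.

Definition scaled_parking_fst (p : parking n.+1) : R :=
  (parking_fst p)%:R / n.+1%:R.

Lemma measurable_scaled_parking_fst :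
  measurable_fun [set: parking n.+1] scaled_parking_fst.
Proof. by []. Qed.

HB.instance Definition _ := isMeasurableFun.Build _ _ _ _
  scaled_parking_fst measurable_scaled_parking_fst.

End first_coordinate.
Arguments scaled_parking_fst R n p : clear implicits.

(* X n converges in distribution to mu: the distribution functions converge
   at every continuity point of the distribution function of mu. The X n may
   live on different probability spaces. *)
Definition cvg_in_distribution {R : realType} {d : nat -> measure_display}
    {T : forall n, measurableType (d n)} {P : forall n, probability (T n) R}
    (X : forall n, {RV (P n) >-> R}) (mu : probability R R) : Prop :=
  forall x : R, {for x, continuous (fun r : R => mu `]-oo, r]%classic)} ->
    cdf (X n) x @[n --> \oo] --> mu `]-oo, x]%classic.

(* At x = 0 the formula evaluates to 0, its limit at 0^+, because the
   factor in front of the logarithm vanishes. *)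
Definition limit_cdf {R : realType} (c x : R) : R :=
  if 0 < c then
    x + c^-1 * (expR (c * x) - 1) *
      ln ((1 - expR (- c)) / (1 - expR (- (c * x))))
  else
    x + `|c|^-1 * (1 - expR (- (`|c| * x))) *
      ln ((expR `|c| - 1) / (expR (`|c| * x) - 1)).

Definition limit_density {R : realType} (c x : R) : R :=
  if 0 < c then
    expR (c * x) * ln ((1 - expR (- c)) / (1 - expR (- (c * x))))
  else
    expR (- (`|c| * x)) * ln ((expR `|c| - 1) / (expR (`|c| * x) - 1)).

(* Main.v *)
(* The Lehmer code s |-> (inversions_lt s j)_j is a bijection from 'S_n onto the
   codes (k_j) with k_j <= j, and it turns q ^ inversions into a product. Hence
   under the Mallows measure inversions_lt s j is a truncated geometric variable,
   and as the first letter of the second permutation is uniform, with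
   [j] = 1 + q + ... + q^(j-1),
     P(pi_1 <= m) = 1/N \sum_(1 <= j <= N) [min(m, j)] / [j]
                  = m/N + [m]/N \sum_(m < j <= N) 1/[j].
   Since 1 - 1/z <= ln z <= z - 1 at z = [j] / (q [j-1]) gives
     1/[j] <= ln ([j] / (q [j-1])) <= 1/(q [j-1]),
   the last sum is squeezed between telescoping sums of logarithms, whose limits
   follow from q ^ m --> e^(cx) for q = 1 + c/N and m/N --> x. The limit F_c
   satisfies F_c' = f_c on ]0, 1] and F_c(0+) = 0, so f_c is a probability
   density with distribution function F_c. *)
Require Import Defs.
From HB Require Import structures.
From mathcomp Require Import all_boot all_order all_algebra all_fingroup.
From mathcomp Require Import all_classical all_reals all_analysis.
From mathcomp Require Import measurable_realfun ring.
Set Implicit Arguments.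
Unset Strict Implicit.
Unset Printing Implicit Defensive.
Import Order.TTheory GRing.Theory Num.Theory.
Import numFieldNormedType.Exports.
Local Open Scope classical_set_scope.
Local Open Scope ring_scope.

(** * Lehmer code *)

Section lehmer_code.
Local Open Scope set_scope.
Local Open Scope nat_scope.
Variable n : nat.
Implicit Types s t : 'S_n.

(** Reindexing by [s^-1] trades pairs of positions for pairs of letters; grouping the inversions by
    their larger letter gives the code. *)
Lemma inversionsE s : inversions s = \sum_(j < n) inversions_lt s j.
Proof.
rewrite /inversions (reindex_inj (@perm_inj _ (s^-1)%g)) /=.
under eq_bigr => a _.
  rewrite big_mkcond (reindex_inj (@perm_inj _ (s^-1)%g)) /=.
  under eq_bigr => b _ do rewrite !permKV.
  over.
apply: eq_bigr => a _; rewrite /inversions_lt [RHS]big_mkcond.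
by apply: eq_bigr => b _; case: (_ < _); case: (_ < _).
Qed.

Lemma card_ord_lt (j : 'I_n) : #|[set i : 'I_n | i < j]| = j.
Proof.
by rewrite -sum1dep_card (big_ord_narrow (ltnW (ltn_ord j))) sum1_card card_ord.
Qed.

Let larger s (j : 'I_n) := [set i : 'I_n | (i < j) && ((s^-1)%g j < (s^-1)%g i)].

Let inversions_ltE s j : inversions_lt s j = #|larger s j|.
Proof.
rewrite -sum1dep_card /inversions_lt big_mkcond [RHS]big_mkcond.
by apply: eq_bigr => i _; do 2!case: (_ < _).
Qed.

(* Both sets are final segments, for the order of positions, of the letters
   below k: hence they are comparable. *)
Let larger_subset s t (k : 'I_n) :
  (forall i j : 'I_n, i < k -> j < k ->
    ((s^-1)%g i < (s^-1)%g j) = ((t^-1)%g i < (t^-1)%g j)) ->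
  ~~ (larger s k \subset larger t k) -> larger t k \subset larger s k.
Proof.
move=> st /subsetPn[i]; rewrite !inE => /andP[ik ski]; rewrite ik /= => tki.
apply/fintype.subsetP => j; rewrite !inE => /andP[jk tkj]; rewrite jk /=.
apply: (ltn_trans ski); rewrite st//; apply: leq_ltn_trans tkj.
by rewrite leqNgt.
Qed.

(** Induction on [m]: the order of the letters below [m] is known, so the letters below [m] to the
    right of [m] form comparable sets in [s] and [t]. Equal code entries give them equal size, hence
    they coincide, which fixes the place of [m]. *)
Let inversions_lt_order s t (m : nat) : inversions_lt s =1 inversions_lt t ->
  forall i j : 'I_n, i < m -> j < m ->
    ((s^-1)%g i < (s^-1)%g j) = ((t^-1)%g i < (t^-1)%g j).
Proof.
move=> st; elim: m => // m IH.
have large (k : 'I_n) : k = m :> nat -> larger s k = larger t k.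
  move=> km; have cst : #|larger s k| = #|larger t k| by rewrite -!inversions_ltE st.
  have [sub|nsub] := boolP (larger s k \subset larger t k).
    by apply/eqP; rewrite eqEcard sub cst /=.
  apply/esym/eqP; rewrite eqEcard cst leqnn andbT.
  by apply: larger_subset nsub => i j; rewrite km; exact: IH.
have large' (k i : 'I_n) : k = m :> nat -> i < m ->
    ((s^-1)%g k < (s^-1)%g i) = ((t^-1)%g k < (t^-1)%g i).
  by move=> km im; move/setP/(_ i): (large _ km); rewrite !inE km im.
(* Distinct letters have distinct positions, so the case where [j] is the top letter reduces to the
   one where [i] is. *)
have flip (u : {perm _}) (i j : 'I_n) : i != j -> ((u^-1)%g i < (u^-1)%g j) = ~~ ((u^-1)%g j < (u^-1)%g i).
  rewrite -(inj_eq (@perm_inj _ (u^-1)%g)) -val_eqE /= -leqNgt.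
  by case: ltngtP.
move=> i j; rewrite !ltnS leq_eqVlt => /orP[/eqP im|im]; rewrite leq_eqVlt => /orP[/eqP jm|jm].
- have -> : i = j by apply: val_inj; rewrite /= im jm.
  by rewrite !ltnn.
- exact: large'.
- have ij : i != j by rewrite -val_eqE /= jm ltn_eqF.
  by rewrite !(flip _ i j ij) large'.
- exact: IH.
Qed.

Lemma inversions_lt_inj s t : inversions_lt s =1 inversions_lt t -> s = t.
Proof.
move=> st; apply: invg_inj; apply/permP => i; apply: val_inj => /=.
(* A permutation is recovered from the relative order of its values: each value is the number of
   smaller ones. *)
have rank (u : {perm 'I_n}) : u i = #|[set j | u j < u i]| :> nat.
  rewrite -[LHS]card_ord_lt -[LHS](card_preimset _ (@perm_inj _ u)).
  by apply: eq_card => j; rewrite !inE.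
rewrite [LHS]rank [RHS]rank; apply: eq_card => j; rewrite !inE.
by rewrite (@inversions_lt_order s t n st).
Qed.

Definition lehmer_code s : {ffun 'I_n -> 'I_n} :=
  [ffun j => Ordinal (leq_ltn_trans (inversions_lt_le s j) (ltn_ord j))].

Lemma lehmer_code_inj : injective lehmer_code.
Proof.
move=> s t /ffunP st; apply: inversions_lt_inj => j.
by have := congr1 val (st j); rewrite !ffunE.
Qed.

(** One inclusion is the bound [inversions_lt_le]; equality follows by counting, since both sides
    have [n!] elements. *)
Lemma codom_lehmer_code :
  codom lehmer_code =i family (fun j k : 'I_n => k <= j).
Proof.
apply/subset_cardP; last first.
  apply/fintype.subsetP => _ /codomP[s ->]; apply/familyP => j.
  by rewrite unfold_in ffunE /= inversions_lt_le.
rewrite (card_codom lehmer_code_inj) card_Sn card_family.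
rewrite foldrE big_map big_enum /=.
rewrite fact_prod big_add1 /= big_mkord; apply: eq_bigr => j _.
rewrite -sum1_card; under eq_bigl do rewrite unfold_in -ltnS.
by rewrite (big_ord_narrow (ltn_ord j)) sum1_card card_ord.
Qed.

End lehmer_code.

Lemma sum_prod_inversions_lt (R : comPzSemiRingType) n (F : nat -> nat -> R) :
  \sum_(s : 'S_n) \prod_(j < n) F j (inversions_lt s j) =
  \prod_(j < n) \sum_(k < j.+1) F j k.
Proof.
transitivity (\prod_(j < n) \sum_(k < n | (k <= j)%N) F j k); last first.
  apply: eq_bigr => j _; under eq_bigl do rewrite -ltnS.
  by rewrite (big_ord_narrow (ltn_ord j)).
rewrite (bigA_distr_big_dep (fun j k : 'I_n => (k <= j)%N) (fun j k : 'I_n => F j k)).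
rewrite -(eq_bigl _ _ (@codom_lehmer_code n)).
rewrite -big_uniq ?codomE /=; last by rewrite map_inj_uniq ?enum_uniq//; exact: lehmer_code_inj.
rewrite big_map big_enum /=; apply: eq_bigr => s _.
by apply: eq_bigr => j _; rewrite ffunE.
Qed.

(** * Law of the first coordinate *)

Section first_coordinate_law.
Context {R : realType}.

(** The q-number [j], kept as a sum rather than a quotient by [q - 1], so that [q = 1] is no
    exception. *)
Definition qnum (q : R) (j : nat) : R := \sum_(i < j) q ^+ i.

Lemma qnum_gt0 (q : R) j : 0 < q -> (0 < j)%N -> 0 < qnum q j.
Proof.
case: j => // j q0 _; rewrite /qnum big_ord_recl expr0 ltr_pwDl//.
by apply: sumr_ge0 => i _; rewrite exprn_ge0// ltW.
Qed.

Lemma qnum_lt (q : R) m j :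
  \sum_(k < j) (k < m)%N%:R * q ^+ k = qnum q (minn m j).
Proof.
rewrite /qnum (big_ord_widen_cond j predT (fun i => q ^+ i)) ?geq_minr//=.
rewrite [RHS]big_mkcond; apply: eq_bigr => k _.
by rewrite leq_min ltn_ord andbT; case: ifP; rewrite ?mul1r ?mul0r.
Qed.

Lemma mallows_constE n (q : {posnum R}) :
  mallows_const n q = \prod_(j < n) qnum q%:num j.+1.
Proof.
rewrite /qnum -(sum_prod_inversions_lt n (fun _ k => q%:num ^+ k)).
by apply: eq_bigr => s _; rewrite inversionsE expr_sum.
Qed.

(** The entries of the code are independent: numerator and normalizing constant factor over the
    letters, and all factors except that of [j] cancel. *)
Lemma mallows_inversions_lt n (q : {posnum R}) (j : 'I_n) m :
  mallows n q [set s | (inversions_lt s j < m)%N] =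
  (qnum q%:num (minn m j.+1) / qnum q%:num j.+1)%:E.
Proof.
rewrite /mallows esum_mkcond.
rewrite (eq_esum (b := fun s => ((inversions_lt s j < m)%N%:R * mallows_pmf q s)%:E)); last first.
  move=> s _; case: ifPn => [/set_mem/= ->|]; first by rewrite mul1r.
  by rewrite notin_setE/= => /negP/negPf ->; rewrite mul0r.
rewrite esum_setT_fin; last by move=> s; rewrite mulr_ge0 ?mallows_pmf_ge0.
congr _%:E; rewrite /mallows_pmf; under eq_bigr do rewrite mulrA.
rewrite -mulr_suml mallows_constE.
(* The indicator of the event is absorbed into the factor of index [j]. *)
pose F i k := (if i == j :> nat then (k < m)%N%:R else 1) * q%:num ^+ k.
transitivity ((\sum_(s : 'S_n) \prod_(i < n) F i (inversions_lt s i)) /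
    \prod_(i < n) qnum q%:num i.+1).
  congr (_ / _); apply: eq_bigr => s _; rewrite big_split/= inversionsE expr_sum.
  congr (_ * _); rewrite (bigD1 j)//= eqxx big1 ?mulr1// => i ij.
  by rewrite val_eqE (negPf ij).
rewrite sum_prod_inversions_lt (bigD1 j)//= [X in _ / X](bigD1 j)//=.
have -> : \prod_(i < n | i != j) \sum_(k < i.+1) F i k =
    \prod_(i < n | i != j) qnum q%:num i.+1.
  apply: eq_bigr => i ij; apply: eq_bigr => k _.
  by rewrite /F val_eqE (negPf ij) mul1r.
rewrite invfM mulrACA divff ?mulr1; last first.
  by apply/prodf_neq0 => i _; rewrite gt_eqF ?qnum_gt0.
by congr (_ / _); rewrite -qnum_lt; apply: eq_bigr => k _; rewrite /F eqxx.
Qed.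

(** Composing with a transposition of two values maps one fibre of [t |-> t i] injectively into
    another, so the [n] fibres have the same size. *)
Lemma uniform_perm_eq n (i j : 'I_n) :
  uniform_perm R n [set t : 'S_n | t i = j] = n%:R^-1%:E.
Proof.
have n0 : (0 < n)%N by case: n i {j} => [[]|].
have E k : uniform_perm R n [set t : 'S_n | t i = k] =
    ((n`!)%:R^-1 *+ #|[pred t : 'S_n | t i == k]|)%:E.
  rewrite /uniform_perm esum_mkcond.
  rewrite (eq_esum (b := fun s : 'S_n => ((s i == k)%:R * (n`!)%:R^-1)%:E)); last first.
    move=> s _; case: ifPn => [/set_mem/= ->|]; first by rewrite eqxx mul1r.
    by rewrite notin_setE/= => /eqP/negPf ->; rewrite mul0r.
  rewrite esum_setT_fin; last by move=> s; rewrite mulr_ge0// invr_ge0.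
  congr _%:E; rewrite -sumr_const [RHS]big_mkcond; apply: eq_bigr => s _.
  by rewrite inE; case: (_ == _); rewrite ?mul1r ?mul0r.
have H k l : (#|[pred t : 'S_n | t i == k]| <= #|[pred t : 'S_n | t i == l]|)%N.
  rewrite -(fintype.card_image (@mulIg _ (tperm k l))) subset_leq_card//.
  apply/fintype.subsetP => u /fintype.imageP[t]; rewrite inE => /eqP ti ->{u}.
  by rewrite inE permM ti tpermL.
have cardE : (n`! = n * #|[pred t : 'S_n | t i == j]|)%N.
  rewrite -card_Sn -sum1_card (partition_big (fun t : 'S_n => t i) predT)//=.
  transitivity (\sum_(k < n) #|[pred t : 'S_n | t i == j]|)%N; last first.
    by rewrite sum_nat_const card_ord.
  apply: eq_bigr => k _.
  by rewrite sum1_card; apply/eqP; rewrite eqn_leq !H.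
rewrite E; congr _%:E; rewrite -[LHS]mulr_natr cardE natrM invfM -mulrA mulVf ?mulr1//.
by rewrite pnatr_eq0; apply/eqP => c0; move: (fact_gt0 n); rewrite cardE c0 muln0.
Qed.

Lemma parking_mallows_fst_le n (q : {posnum R}) m :
  parking_mallows n.+1 q [set p | (parking_fst p <= m)%N] =
  (n.+1%:R^-1 * \sum_(j < n.+1) qnum q%:num (minn m j.+1) / qnum q%:num j.+1)%:E.
Proof.
rewrite /parking_mallows /distribution /pushforward /=.
pose A (j : 'I_n.+1) : set ('S_n.+1 * 'S_n.+1) :=
  [set s | (inversions_lt s j < m)%N] `*` [set t : 'S_n.+1 | t ord0 = j].
(* The event splits into disjoint rectangles according to the first letter [j] of the second
   permutation; the shift in [inversions_lt1] turns [<= m] into [< m]. *)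
rewrite (_ : _ @^-1` _ = \big[setU/set0]_(j < n.+1) A j); last first.
  apply/seteqP; split => -[s t] /=.
    rewrite /parking_fst ffunE /inversions_lt1 addn1 => stm.
    by rewrite -bigcup_seq; exists (t ord0) => //=; rewrite mem_index_enum.
  rewrite -bigcup_seq => -[j _ []] /= sjm tj.
  by rewrite /parking_fst ffunE /inversions_lt1 addn1 tj.
rewrite measure_semi_additive_ord/=; last 3 first.
- by move=> j; apply: measurableX.
- by move=> i j _ _ [[s t] [[_ /= <-] [_ /= <-]]].
- by apply: bigsetU_measurable => j _; apply: measurableX.
rewrite mulr_sumr -sumEFin; apply: eq_bigr => j _.
rewrite product_measure1E//.
by have /= -> := mallows_inversions_lt q j m; rewrite uniform_perm_eq -EFinM mulrC.
Qed.

End first_coordinate_law.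

(** * Limit of the distribution functions *)

Section closed_forms.
Context {R : realType} (c : R).
Hypothesis c_neq0 : c != 0.

(* For c < 0 numerator and denominator of the fraction both change sign. *)
Lemma limit_cdfE x : limit_cdf c x =
  x + c^-1 * (expR (c * x) - 1) *
    ln ((1 - expR (- c)) / (1 - expR (- (c * x)))).
Proof.
rewrite /limit_cdf; case: ifPn => //; rewrite -leNgt => c0.
rewrite ler0_norm// mulNr opprK invrN mulNr -mulrN opprB; congr (_ + _ * ln _).
by rewrite -(opprB 1) -[in LHS](opprB 1 (expR (- (c * x)))) invrN mulrNN.
Qed.

Lemma limit_densityE x : limit_density c x =
  expR (c * x) * ln ((1 - expR (- c)) / (1 - expR (- (c * x)))).
Proof.
rewrite /limit_density; case: ifPn => //; rewrite -leNgt => c0.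
rewrite ler0_norm// mulNr opprK; congr (_ * ln _).
by rewrite -(opprB 1) -[in LHS](opprB 1 (expR (- (c * x)))) invrN mulrNN.
Qed.

(** Dividing by [c] makes the sign independent of that of [c], so that logarithms of ratios can be
    handled for both signs at once. *)
Lemma expRN_ratio_gt0 x : 0 < x -> 0 < (1 - expR (- (c * x))) / c.
Proof.
move=> x0; have [c0|c0] : 0 < c \/ c < 0 by move: c_neq0; case: ltgtP => //; tauto.
  by rewrite divr_gt0// subr_gt0 -expR0 ltr_expR oppr_lt0 mulr_gt0.
by rewrite ltr_ndivlMr// mul0r subr_lt0 -expR0 ltr_expR oppr_gt0 nmulr_rlt0.
Qed.

End closed_forms.

Section log_bounds.
Context {R : realType}.

Lemma ln_le_sub1 (z : R) : 0 < z -> ln z <= z - 1.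
Proof.
move=> z0; rewrite -{1}(subrKC 1 z) le_ln1Dx//.
by rewrite ltrBrDr addrC subrr.
Qed.

Lemma sub1V_le_ln (z : R) : 0 < z -> 1 - z^-1 <= ln z.
Proof.
move=> z0; rewrite -lerN2 opprB -lnV ?posrE// ln_le_sub1//.
by rewrite invr_gt0.
Qed.

End log_bounds.

(** * Telescoping bounds for sums of inverse q-numbers *)

Section q_number_sums.
Context {R : realType} (q : R).
Hypothesis q_gt0 : 0 < q.

Lemma qnumS j : qnum q j.+1 = 1 + q * qnum q j.
Proof.
rewrite /qnum big_ord_recl expr0 mulr_sumr; congr (_ + _).
by apply: eq_bigr => i _; rewrite exprS.
Qed.

(** Discrete primitive: its increments are the logarithms that bracket the inverse q-numbers. *)
Let g M := ln (qnum q M / q ^+ M).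

Let gB M : (0 < M)%N -> g M.+1 - g M = ln (qnum q M.+1 / (q * qnum q M)).
Proof.
move=> M0; rewrite /g -ln_div ?posrE ?divr_gt0 ?exprn_gt0 ?qnum_gt0//.
congr ln; rewrite exprS.
have ? : q != 0 by rewrite gt_eqF.
have ? : q ^+ M != 0 by rewrite expf_neq0.
have ? : qnum q M != 0 by rewrite gt_eqF// qnum_gt0.
by field; apply/and3P.
Qed.

(** Termwise [1 - 1/z <= ln z] at z = [j+1] / (q [j]), where 1 - 1/z = 1/[j+1] by [qnumS].
    Positivity of [m] keeps [j] nonzero. *)
Lemma sum_inv_qnum_le m N : (0 < m <= N)%N ->
  \sum_(m <= j < N) (qnum q j.+1)^-1 <= g N - g m.
Proof.
move=> /andP[m0 mN]; rewrite -telescope_sumr// big_nat_cond [leRHS]big_nat_cond.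
apply: ler_sum => j; rewrite andbT => /andP[mj _].
have j0 := leq_trans m0 mj.
rewrite gB//; apply: le_trans (sub1V_le_ln _); last first.
  by rewrite divr_gt0 ?mulr_gt0 ?qnum_gt0.
rewrite invf_div -[X in X - _](@divff _ (qnum q j.+1)); last by rewrite gt_eqF// qnum_gt0.
by rewrite -mulrBl {2}qnumS addrK mul1r.
Qed.

(** Termwise [ln z <= z - 1] at z = [j+2] / (q [j+1]), where z - 1 = 1 / (q [j+1]); hence the factor
    [q] and the shift of both indices by one. *)
Lemma le_sum_inv_qnum m N : (m <= N)%N ->
  q * (g N.+1 - g m.+1) <= \sum_(m <= j < N) (qnum q j.+1)^-1.
Proof.
move=> mN; rewrite -[g _ - _](@telescope_sumr _ _ _ (fun k => g k.+1))//.
rewrite mulr_sumr; apply: ler_sum => j _.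
rewrite gB//; have z0 : 0 < qnum q j.+2 / (q * qnum q j.+1).
  by rewrite divr_gt0 ?mulr_gt0 ?qnum_gt0.
apply: le_trans (ler_wpM2l (ltW q_gt0) (ln_le_sub1 z0)) _.
rewrite (qnumS j.+1) mulrDl mul1r divff ?addrK; last first.
  by rewrite gt_eqF ?mulr_gt0 ?qnum_gt0.
by rewrite invfM mulrA divff ?mul1r// gt_eqF.
Qed.

Lemma sum_qnum_min m N : (m <= N)%N ->
  \sum_(j < N) qnum q (minn m j.+1) / qnum q j.+1 =
  m%:R + qnum q m * \sum_(m <= j < N) (qnum q j.+1)^-1.
Proof.
move=> mN; rewrite -(big_mkord predT (fun j => qnum q (minn m j.+1) / qnum q j.+1)).
rewrite (@big_cat_nat _ _ _ m)//=; congr (_ + _).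
  (* For [j < m] the minimum is [j.+1], so the ratio is 1. *)
  rewrite big_nat (eq_bigr (fun=> 1)) => [|j /andP[_ jm]].
    by rewrite -big_nat sumr_const_nat subn0.
  by rewrite (minn_idPr jm) divff// gt_eqF// qnum_gt0.
rewrite mulr_sumr big_nat [RHS]big_nat; apply: eq_bigr => j /andP[mj _].
by rewrite (minn_idPl (leqW mj)).
Qed.

End q_number_sums.

Section limit_of_cdf.
Context {R : realType} (c : R) (q : nat -> {posnum R}).
Hypothesis c_neq0 : c != 0.
Hypothesis qE : forall n : nat, `|c| < n.+1%:R -> (q n)%:num = 1 + c / n.+1%:R.

Local Notation Q n := ((q n)%:num).

Let near_qE : \forall n \near \oo, Q n = 1 + c / n.+1%:R.
Proof.
near=> n; apply: qE.
near: n; have [N _ NP] := nbhs_infty_gtr (`|c|); exists N => // n Nn.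
by apply: lt_trans (NP _ Nn) _; rewrite ltr_nat.
Unshelve. all: by end_near. Qed.

Let near_qB : \forall n \near \oo, n.+1%:R * (Q n - 1) = c.
Proof.
near=> n; have -> : Q n = 1 + c / n.+1%:R by near: n.
by rewrite addrC addKr mulrC divfK.
Unshelve. all: by end_near. Qed.

Let cvg_q : Q n @[n --> \oo] --> (1 : R).
Proof.
apply: (@cvg_trans _ (1 + c / n.+1%:R @[n --> \oo])).
  by apply: near_eq_cvg; near=> n; apply/esym; near: n.
suff : 1 + c / n.+1%:R @[n --> \oo] --> 1 + c * 0 by rewrite mulr0 addr0.
apply: cvgD; first exact: cvg_cst.
by apply: cvgM; [exact: cvg_cst|exact: cvg_harmonic].
Unshelve. all: by end_near. Qed.

(** The bounds on the logarithm at [Q n], multiplied by [n.+1], squeeze the sequence between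
    [c / Q n] and [c]. *)
Let cvg_nln : n.+1%:R * ln (Q n) @[n --> \oo] --> c.
Proof.
apply: (@squeeze_cvgr _ _ _ _ (fun n => c / Q n) (fun=> c)).
- near=> n; have cE : n.+1%:R * (Q n - 1) = c by near: n.
  rewrite -cE -mulrA !ler_pM2l ?ltr0n// ln_le_sub1// andbT.
  by rewrite mulrBl divff// mul1r sub1V_le_ln.
- suff : c / Q n @[n --> \oo] --> c / 1 by rewrite divr1.
  apply: cvgM; first exact: cvg_cst.
  by apply: cvgV => //; exact: oner_neq0.
- exact: cvg_cst.
Unshelve. all: by end_near. Qed.

Let cvg_qX (u : nat -> nat) (y : R) :
  (u n)%:R / n.+1%:R @[n --> \oo] --> y ->
  Q n ^+ u n @[n --> \oo] --> expR (c * y).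
Proof.
move=> uy; rewrite [X in X @ _](_ : _ =
    expR \o (fun n => (n.+1%:R * ln (Q n)) * ((u n)%:R / n.+1%:R))); last first.
  apply/funext => n /=; rewrite [_ * ln _]mulrC -mulrA (mulrC n.+1%:R) divfK ?pnatr_eq0//.
  rewrite mulr_natr.
  by rewrite -lnXn// lnK// posrE exprn_gt0.
by apply: continuous_cvg; [exact: continuous_expR|exact: cvgM].
Qed.

(** Since [n.+1 * (q - 1) = c] eventually, the geometric sum formula turns the quotient into
    [(q ^ u - 1) / c]. *)
Let cvg_qnum (u : nat -> nat) (y : R) :
  (u n)%:R / n.+1%:R @[n --> \oo] --> y ->
  qnum (Q n) (u n) / n.+1%:R @[n --> \oo] --> c^-1 * (expR (c * y) - 1).
Proof.
move=> uy; apply: (@cvg_trans _ (c^-1 * (Q n ^+ u n - 1) @[n --> \oo])).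
  apply: near_eq_cvg; near=> n; have cE : n.+1%:R * (Q n - 1) = c by near: n.
  rewrite subrX1 -/(qnum _ _); apply: (mulfI c_neq0).
  rewrite mulVKf// -[in RHS]cE [n.+1%:R * _]mulrC -mulrA [n.+1%:R * _]mulrC.
  by rewrite divfK ?pnatr_eq0.
apply: cvgM; first exact: cvg_cst.
by apply: cvgB; [exact: cvg_qX|exact: cvg_cst].
Unshelve. all: by end_near. Qed.

Let g n M := ln (qnum (Q n) M / Q n ^+ M).

(** Dividing both arguments of [ln] by [n.+1] does not change the difference and makes them
    converge; [y] and [z] are positive, so the limits stay in the domain of [ln]. *)
Let cvg_gB (u v : nat -> nat) (y z : R) :
  (\forall n \near \oo, (0 < u n)%N) -> (\forall n \near \oo, (0 < v n)%N) ->
  0 < y -> 0 < z ->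
  (u n)%:R / n.+1%:R @[n --> \oo] --> y ->
  (v n)%:R / n.+1%:R @[n --> \oo] --> z ->
  g n (u n) - g n (v n) @[n --> \oo] -->
    ln ((1 - expR (- (c * y))) / (1 - expR (- (c * z)))).
Proof.
move=> u0 v0 y0 z0 uy vz.
pose k (w : nat -> nat) n := qnum (Q n) (w n) / n.+1%:R / Q n ^+ w n.
have kE (w : nat -> nat) t : (w n)%:R / n.+1%:R @[n --> \oo] --> t ->
    k w n @[n --> \oo] --> (1 - expR (- (c * t))) / c.
  move=> wt; rewrite (_ : _ / c = c^-1 * (expR (c * t) - 1) / expR (c * t)).
    apply: cvgM; first exact: cvg_qnum.
    by apply: cvgV; [rewrite gt_eqF// expR_gt0|exact: cvg_qX].
  by rewrite expRN -[RHS]mulrA [(_ - 1) / _]mulrBl divff ?gt_eqF ?expR_gt0// mul1r mulrC.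
rewrite (_ : _ / _ = (1 - expR (- (c * y))) / c / ((1 - expR (- (c * z))) / c)); last first.
  by rewrite invf_div mulrA divfK.
apply: (@cvg_trans _ (ln (k u n / k v n) @[n --> \oo])).
  apply: near_eq_cvg; near=> n.
  have un0 : (0 < u n)%N by near: n.
  have vn0 : (0 < v n)%N by near: n.
  rewrite /g -ln_div ?posrE ?divr_gt0 ?exprn_gt0 ?qnum_gt0//; congr ln.
  rewrite /k -(mulrAC _ (Q n ^+ u n)^-1) -(mulrAC _ (Q n ^+ v n)^-1).
  by rewrite [(_ / n.+1%:R)^-1]invf_div mulrA divfK// pnatr_eq0.
apply: continuous_cvg.
  by apply: continuous_ln; rewrite divr_gt0// expRN_ratio_gt0.
apply: cvgM; first exact: kE.
by apply: cvgV; [rewrite gt_eqF// expRN_ratio_gt0|exact: kE].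
Unshelve. all: by end_near. Qed.

Let cvg_succ (u : nat -> nat) (y : R) :
  (u n)%:R / n.+1%:R @[n --> \oo] --> y -> (u n).+1%:R / n.+1%:R @[n --> \oo] --> y.
Proof.
move=> uy; rewrite -[y]addr0.
under eq_fun do rewrite -natr1 mulrDl mul1r.
by apply: cvgD => //; exact: cvg_harmonic.
Qed.

Lemma cvg_truncn (x : R) : 0 <= x ->
  (Num.truncn (x * n.+1%:R))%:R / n.+1%:R @[n --> \oo] --> x.
Proof.
move=> x0; apply: (@squeeze_cvgr _ _ _ _ (fun n => x - n.+1%:R^-1) (fun=> x)).
- near=> n; have xn0 : 0 <= x * n.+1%:R by rewrite mulr_ge0.
  rewrite ler_pdivrMr ?ltr0n// ler_pdivlMr ?ltr0n// mulrBl mulVf ?pnatr_eq0//.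
  have /andP[-> /ltW] := truncn_itv xn0.
  by rewrite andbT lerBlDr natr1.
- suff : x - n.+1%:R^-1 @[n --> \oo] --> x - 0 by rewrite subr0.
  apply: cvgB; first exact: cvg_cst.
  exact: cvg_harmonic.
- exact: cvg_cst.
Unshelve. all: by end_near. Qed.

Lemma cvg_mean_qnum_ratio (x : R) : 0 < x <= 1 ->
  n.+1%:R^-1 * \sum_(j < n.+1)
    qnum (Q n) (minn (Num.truncn (x * n.+1%:R)) j.+1) / qnum (Q n) j.+1
  @[n --> \oo] --> limit_cdf c x.
Proof.
move=> /andP[x0 x1]; pose m n := Num.truncn (x * n.+1%:R).
have mn n : (m n <= n.+1)%N.
  rewrite -(ler_nat R) (le_trans (_ : _ <= x * n.+1%:R))//.
    by rewrite truncn_le mulr_ge0// ltW.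
  by rewrite ler_piMl.
have mx : (m n)%:R / n.+1%:R @[n --> \oo] --> x by apply/cvg_truncn/ltW.
have n1 : n.+1%:R / n.+1%:R @[n --> \oo] --> (1 : R).
  by under eq_fun do rewrite divff ?pnatr_eq0//; exact: cvg_cst.
have m0 : \forall n \near \oo, (0 < m n)%N.
  near=> n; rewrite /m truncn_gt0 -ler_pdivrMl// mulr1.
  near: n; have [N _ NP] := nbhs_infty_ger x^-1; exists N => // n Nn.
  by apply: le_trans (NP _ Nn) _; rewrite ler_nat.
have -> : limit_cdf c x = x + c^-1 * (expR (c * x) - 1) *
    ln ((1 - expR (- (c * 1))) / (1 - expR (- (c * x)))).
  by rewrite limit_cdfE// mulr1.
under eq_fun do rewrite (sum_qnum_min _ (mn _))// mulrDr [_ * (m _)%:R]mulrC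
  mulrA [_ * qnum _ _]mulrC.
apply: cvgD => //; apply: cvgM; first exact: cvg_qnum.
(* Both bounds have the same limit: [Q n] tends to 1, and shifting an index by one is invisible
   after division by [n.+1]. *)
apply: (@squeeze_cvgr _ _ _ _ (fun n => Q n * (g n n.+2 - g n (m n).+1))
    (fun n => g n n.+1 - g n (m n))).
- near=> n; rewrite le_sum_inv_qnum// sum_inv_qnum_le// mn andbT.
  by near: n.
- set l := ln _; suff : Q n * (g n n.+2 - g n (m n).+1) @[n --> \oo] --> 1 * l.
    by rewrite mul1r.
  apply: cvgM => //.
  by apply: cvg_gB => //; try (exact: nearW); exact: cvg_succ.
- by apply: cvg_gB => //; exact: nearW.
Unshelve. all: by end_near. Qed.

End limit_of_cdf.

(** * Limit law *)

Section limit_density.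
Context {R : realType} (c : R).
Hypothesis c_neq0 : c != 0.

Let v (x : R) : R := 1 - expR (- (c * x)).
Let L (x : R) : R := ln (v 1 / v x).

Let cdfE x : limit_cdf c x = x + c^-1 * (expR (c * x) - 1) * L x.
Proof. by rewrite limit_cdfE// /L /v mulr1. Qed.

Let densityE x : limit_density c x = expR (c * x) * L x.
Proof. by rewrite limit_densityE// /L /v mulr1. Qed.

Let v_neq0 x : 0 < x -> v x != 0.
Proof.
by move=> /(expRN_ratio_gt0 c_neq0) /lt0r_neq0; rewrite mulf_eq0 negb_or => /andP[].
Qed.

Let v_div_gt0 x y : 0 < x -> 0 < y -> 0 < v x / v y.
Proof.
move=> x0 y0; have -> : v x / v y = (v x / c) / (v y / c).
  by rewrite invf_div mulrA divfK.
by rewrite divr_gt0// expRN_ratio_gt0.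
Qed.

(** With [u z = expR (- (c * z))] the density is [L z / u z], so the claim is
    [u x * L y < u y * L x]. No derivative is taken: [L x - L y = ln (v y / v x)] is bounded below
    by [1 - v x / v y]. *)
Lemma limit_density_decreasing :
  {in `]0, 1] &, forall x y : R,
    x < y -> limit_density c y < limit_density c x}.
Proof.
move=> x y; rewrite !in_itv/= => /andP[x0 x1] /andP[y0 y1] xy.
pose u z := expR (- (c * z)); have uE z : v z = 1 - u z by [].
have u0 z : 0 < u z by exact: expR_gt0.
have eE z : expR (c * z) = (u z)^-1 by rewrite /u expRN invrK.
rewrite !densityE !eE mulrC ltr_pdivrMr// -mulrA ltr_pdivlMl// [L x * _]mulrC.
have Ld : (u x - u y) / v y <= L x - L y.
  rewrite /L -ln_div ?posrE ?v_div_gt0//.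
  apply: le_trans (sub1V_le_ln _); last by rewrite divr_gt0 ?v_div_gt0.
  have -> : (v 1 / v x / (v 1 / v y))^-1 = v x / v y.
    move: (v 1) (v x) (v y) (v_neq0 ltr01) (v_neq0 x0) (v_neq0 y0) => r s t r0 s0 t0.
    by field; rewrite r0 s0 t0.
  rewrite -{1}(divff (v_neq0 y0)) -mulrBl (_ : v y - v x = u x - u y)//.
  by rewrite !uE; ring.
(* The estimate [Ld] reduces the claim to [L y < u y / v y] if [c > 0], and to
   the reverse inequality if [c < 0]. *)
suff Lu : (u x - u y) * L y < u y * ((u x - u y) / v y).
  have := lt_le_trans Lu (ler_wpM2l (ltW (u0 y)) Ld).
  by rewrite mulrBl mulrBr ltrD2r.
have [c0|c0] : 0 < c \/ c < 0 by move: c_neq0; case: ltgtP => //; tauto.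
  have uxy : 0 < u x - u y by rewrite subr_gt0 ltr_expR ltrN2 ltr_pM2l.
  have u1 z : 0 < z -> u z < 1.
    by move=> z0; rewrite -expR0 ltr_expR oppr_lt0 mulr_gt0.
  rewrite mulrCA ltr_pM2l//.
  have vy0 : 0 < v y by rewrite subr_gt0 u1.
  have v10 : 0 < v 1 by rewrite subr_gt0 u1.
  (* As [v 1 < 1], [L y < ln (1 / v y) <= 1 / v y - 1 = u y / v y]. *)
  apply: (@lt_le_trans _ _ (ln (v y)^-1)).
    rewrite ltr_ln ?posrE ?invr_gt0 ?v_div_gt0//.
    by rewrite ltr_pdivrMr// mulVf ?v_neq0// /v gtrBl u0.
  apply: le_trans (ln_le_sub1 _) _; first by rewrite invr_gt0.
  by rewrite -{1}(divff (v_neq0 y0)) -[X in X - _]mul1r -mulrBl uE subKr.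
have uxy : u x - u y < 0 by rewrite subr_lt0 ltr_expR ltrN2 ltr_nM2l.
have u1 z : 0 < z -> 1 < u z.
  by move=> z0; rewrite -expR0 ltr_expR oppr_gt0 nmulr_rlt0.
(* Here 0 separates the two sides: [u y / v y] is negative, while [v 1 / v y >= 1] makes [L y]
   nonnegative. *)
rewrite mulrCA ltr_nM2l//; apply: (@lt_le_trans _ _ 0).
  by rewrite pmulr_rlt0// invr_lt0 subr_lt0 u1.
have vy0 : v y < 0 by rewrite subr_lt0 u1.
apply: ln_ge0; rewrite ler_ndivlMr// mul1r lerD2l lerN2 ler_expR lerN2.
by rewrite ler_nM2l.
Qed.

Lemma limit_density1 : limit_density c 1 = 0.
Proof. by rewrite densityE /L divff ?v_neq0// ln1 mulr0. Qed.

Lemma limit_density_ge0 x : 0 < x <= 1 -> 0 <= limit_density c x.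
Proof.
move=> /andP[x0]; rewrite le_eqVlt => /predU1P[->|x1].
  by rewrite limit_density1.
rewrite -limit_density1 ltW// limit_density_decreasing// in_itv/= ?ltr01 ?lexx//.
by rewrite x0 ltW.
Qed.

Lemma limit_cdf0 : limit_cdf c 0 = 0.
Proof. by rewrite cdfE mulr0 expR0 subrr mulr0 mul0r addr0. Qed.

Lemma limit_cdf1 : limit_cdf c 1 = 1.
Proof. by rewrite cdfE /L divff ?v_neq0// ln1 mulr0 addr0. Qed.

Let is_derive_v (x : R) : is_derive x (1 : R) v (c * expR (- (c * x))).
Proof.
rewrite /v.
apply: is_derive_eq.
by rewrite /GRing.scale/= !(mulr0, add0r, mulr1, mul1r) mulrN opprK mulrC.
Qed.

Let is_derive_L (x : R) : 0 < x ->
  is_derive x (1 : R) L (- (c * expR (- (c * x)) / v x)).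
Proof.
move=> x0.
have dVx : is_derive x (1 : R) (fun y => v 1 / v y) (- (v 1 * (c * expR (- (c * x))) / v x ^+ 2)).
  have := is_deriveV (v_neq0 x0) (is_derive_v x).
  move=> H; apply: is_derive_eq.
  by rewrite /GRing.scale/=; field; rewrite v_neq0.
have H := @is_derive1_comp _ (@ln R) (fun y => v 1 / v y) x _ _ (is_derive1_ln (v_div_gt0 ltr01 x0)) dVx.
rewrite (_ : - _ = (v 1 / v x)^-1 * - (v 1 * (c * expR (- (c * x))) / v x ^+ 2)) //.
by field; rewrite !v_neq0.
Qed.

(** In the product rule the term containing the derivative of [L] equals -1 and cancels the
    derivative of the summand [x]. *)
Lemma is_derive_limit_cdf (x : R) : 0 < x ->
  is_derive x (1 : R) (limit_cdf c) (limit_density c x).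
Proof.
move=> x0.
have -> : limit_cdf c = (fun x => x + c^-1 * (expR (c * x) - 1) * L x).
  by apply/funext => y; exact: cdfE.
have dL := is_derive_L x0.
apply: is_derive_eq.
rewrite densityE /GRing.scale/= -/(v x) -/(L x) !expRN /v expRN.
have vx0 := v_neq0 x0; rewrite /v expRN in vx0.
field; rewrite c_neq0 gt_eqF ?expR_gt0//=.
by apply: contra_neq vx0 => /subr0_eq ->; rewrite invr1 subrr.
Qed.

Lemma limit_density_continuous (x : R) : 0 < x ->
  {for x, continuous (limit_density c)}.
Proof.
move=> x0; have dL := is_derive_L x0.
apply: differentiable_continuous; apply/derivable1_diffP.
rewrite (_ : limit_density c = fun x => expR (c * x) * L x); last first.
  by apply/funext => y; exact: densityE.
exact: ex_derive.
Qed.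

(* ln z <= 2 sqrt z *)
Let L_le x : 0 < x -> v x / c * L x <=
  Num.sqrt (v 1 / c) * Num.sqrt (v x / c) *+ 2.
Proof.
move=> x0; have w0 := expRN_ratio_gt0 c_neq0 x0; have w1 := expRN_ratio_gt0 c_neq0 ltr01.
rewrite -/(v x) in w0; rewrite -/(v 1) in w1.
have -> : L x = ln ((v 1 / c) / (v x / c)) by rewrite /L invf_div mulrA divfK.
move: (v 1 / c) (v x / c) w0 w1 => s t t0 s0.
have r0 : 0 < Num.sqrt (s / t) by rewrite sqrtr_gt0 divr_gt0.
rewrite -[s / t](sqr_sqrtr (divr_ge0 (ltW s0) (ltW t0))) lnXn// mulrnAr lerMn2r/=.
apply: le_trans (ler_wpM2l (ltW t0) (ltW (ln_sublinear r0))) _.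
rewrite -[X in X * _](sqr_sqrtr (ltW t0)) expr2 -mulrA -(sqrtrM _ (ltW t0)).
by rewrite [t * _]mulrC divfK ?gt_eqF// mulrC.
Qed.

(** [L] blows up at 0, but only against the factor [v x / c]: nonnegativity of the density gives the
    lower bound [x], and [L_le] an upper bound that vanishes with [v]. *)
Lemma limit_cdf_cvg0 : limit_cdf c x @[x --> 0^'+] --> (0 : R).
Proof.
have E x : limit_cdf c x = x + expR (c * x) * (v x / c * L x).
  rewrite cdfE; congr (_ + _); rewrite mulrA; congr (_ * _).
  have -> : expR (c * x) - 1 = expR (c * x) * v x.
    by rewrite /v mulrBr mulr1 expRN divff ?gt_eqF ?expR_gt0.
  by rewrite mulrC -mulrA.
have vc : v x @[x --> (0 : R)] --> v 0.
  apply: differentiable_continuous; apply/derivable1_diffP.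
  by have dv := is_derive_v 0; exact: ex_derive.
have ec : expR (c * x) @[x --> (0 : R)] --> expR (c * 0).
  apply: continuous_cvg; first exact: continuous_expR.
  by apply: cvgM; [exact: cvg_cst|exact: cvg_id].
have v00 : v 0 = 0 by rewrite /v mulr0 oppr0 expR0 subrr.
apply: (@squeeze_cvgr _ _ _ _ idfun (fun x => x + expR (c * x) *
    (Num.sqrt (v 1 / c) * Num.sqrt (v x / c) *+ 2))).
- near=> x; have x0 : 0 < x by [].
  have x1 : x <= 1 by near: x; exact: nbhs_right_le.
  rewrite E lerDl lerD2l ler_pM2l ?expR_gt0// L_le// andbT mulrCA.
  rewrite -densityE mulr_ge0 ?limit_density_ge0 ?x0//.
  by rewrite ltW// expRN_ratio_gt0.
- exact: cvg_at_right_filter.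
- apply: cvg_at_right_filter.
  suff : x + expR (c * x) * (Num.sqrt (v 1 / c) * Num.sqrt (v x / c) *+ 2)
      @[x --> (0 : R)] --> (0 : R) + expR (c * 0) * (Num.sqrt (v 1 / c) * Num.sqrt (v 0 / c) *+ 2).
    by rewrite v00 mul0r sqrtr0 !mulr0 mul0rn mulr0 addr0.
  apply: cvgD; first exact: cvg_id.
  apply: cvgM => //; apply: cvgMn; apply: cvgM; first exact: cvg_cst.
  apply: continuous_cvg; first exact: sqrt_continuous.
  by apply: cvgM => //; exact: cvg_cst.
Unshelve. all: by end_near. Qed.

End limit_density.

(** * The limit law as a probability measure *)

Section limit_law_measure.
Context {R : realType} (c : R).
Hypothesis c_neq0 : c != 0.

(** The interval is open at 0, where the density is unbounded. *)
Definition limit_law (A : set R) : \bar R :=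
  (\int[lebesgue_measure]_(x in A `&` `]0%R, 1%R]) (limit_density c x)%:E)%E.

Let measurable_density :
  measurable_fun (`]0, 1] : set R) (limit_density c).
Proof.
apply: (@measurable_funS _ _ _ _ (`]0, +oo[%classic : set R)) => //.
  by apply: subset_itvl; rewrite bnd_simp.
apply: open_continuous_measurable_fun => //.
by move=> x; rewrite inE/= in_itv/= andbT; exact: limit_density_continuous.
Qed.

Let density_ge0 x : x \in `]0, 1] -> (0 <= (limit_density c x)%:E)%E.
Proof. by rewrite in_itv/= lee_fin; exact: limit_density_ge0. Qed.

Let limit_law0 : limit_law set0 = 0%E.
Proof. by rewrite /limit_law set0I integral_set0. Qed.

Let limit_law_ge0 A : (0 <= limit_law A)%E.
Proof. by apply: integral_ge0 => x [_]; exact: density_ge0. Qed.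

Let limit_law_sigma_additive : semi_sigma_additive limit_law.
Proof.
move=> F mF tF mUF; rewrite /limit_law; apply: cvg_toP.
  apply: ereal_nondecreasing_is_cvgn => m n mn.
  by apply: lee_sum_nneg_natr => // k _ _; exact: limit_law_ge0.
rewrite setI_bigcupl ge0_integral_bigcup//.
- by move=> k; exact: (measurableI _ _ (mF k) (measurable_itv _)).
- apply/measurable_EFinP; apply: measurable_funS measurable_density => //.
  by apply: bigcup_sub => i _; exact: subIsetr.
- by move=> x [k _ [_]]; exact: density_ge0.
- exact: trivIset_setIr.
Qed.

HB.instance Definition _ := isMeasure.Build _ _ _ limit_law
  limit_law0 limit_law_ge0 limit_law_sigma_additive.

(** The fundamental theorem of calculus applies on compact intervals away from 0, where the density
    is continuous. *)
Let limit_law_cc a b : 0 < a -> a < b -> b <= 1 ->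
  limit_law `[a, b] = (limit_cdf c b - limit_cdf c a)%:E.
Proof.
move=> a0 ab b1; rewrite /limit_law setIidl; last first.
  move=> x /=; rewrite !in_itv/= => /andP[ax xb].
  by rewrite (lt_le_trans a0)//= (le_trans xb).
have dF x : a <= x -> is_derive x (1 : R) (limit_cdf c) (limit_density c x).
  by move=> ax; apply: is_derive_limit_cdf => //; exact: lt_le_trans ax.
have cF x : a <= x -> {for x, continuous (limit_cdf c)}.
  move=> ax; apply: differentiable_continuous; apply/derivable1_diffP.
  by have dFx := dF x ax; exact: ex_derive.
rewrite (@continuous_FTC2 _ _ (limit_cdf c)) ?EFinB//.
- apply: continuous_in_subspaceT => x; rewrite inE/= in_itv/= => /andP[ax _].
  by apply: limit_density_continuous => //; exact: lt_le_trans ax.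
- split.
  + move=> x; rewrite in_itv/= => /andP[/ltW ax _].
    by have dFx := dF x ax; exact: ex_derive.
  + by apply: cvg_at_right_filter; exact: cF.
  + by apply: cvg_at_left_filter; apply: cF; exact: ltW.
- move=> x; rewrite in_itv/= => /andP[/ltW ax _].
  by rewrite derive1E; have dFx := dF x ax; exact: derive_val.
Qed.

(** Continuity of the measure from below along [[a n, x]], combined with the limit 0 of [limit_cdf]
    at 0 from the right. *)
Let limit_law_oc x : 0 < x <= 1 -> limit_law `]0, x] = (limit_cdf c x)%:E.
Proof.
(* The denominator starts at 2 so that [a n < x] holds for every [n]. *)
move=> /andP[x0 x1]; pose a n := x / n.+2%:R.
have a0 n : 0 < a n by rewrite divr_gt0.
have an n : a n < x by rewrite ltr_pdivrMr// ltr_pMr// ltr1n.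
have cvga : a n @[n --> \oo] --> (0 : R).
  suff : a n @[n --> \oo] --> x * 0 by rewrite mulr0.
  apply: cvgM; first exact: cvg_cst.
  by have := @cvg_harmonic R; rewrite -(cvg_shiftS (@harmonic R)).
have -> : `]0, x]%classic = \bigcup_n `[a n, x]%classic.
  apply/seteqP; split => [y /=|y [n _] /=]; rewrite !in_itv/= => /andP[y0 yx].
    near \oo => n; exists n => //=; rewrite in_itv/= yx andbT ltW//.
    near: n.
    by apply: (cvgr_lt 0).
  by rewrite (lt_le_trans (a0 n)).
have := @nondecreasing_cvg_mu _ _ _ limit_law (fun n => `[a n, x]%classic).
move=> /(_ (fun=> measurable_itv _) (bigcupT_measurable _ (fun=> measurable_itv _))) H.
apply: (cvg_unique _ (H _)) => //.
  move=> m n mn; apply/subsetPset; apply: subset_itvr.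
  by rewrite bnd_simp ler_pM2l// lef_pV2 ?posrE// ler_nat !ltnS.
rewrite [X in X @ _](_ : _ = EFin \o (fun n => limit_cdf c x - limit_cdf c (a n))); last first.
  by apply/funext => n /=; rewrite limit_law_cc.
apply: cvg_EFin; first exact: nearW.
suff : limit_cdf c x - limit_cdf c (a n) @[n --> \oo] --> limit_cdf c x - 0.
  by rewrite subr0.
apply: cvgB; first exact: cvg_cst.
by have /cvg_at_rightP := limit_cdf_cvg0 c_neq0; apply.
Unshelve. all: by end_near. Qed.

Let limit_law_setT : limit_law setT = 1%E.
Proof.
have := @limit_law_oc 1; rewrite ltr01 lexx limit_cdf1//= => <- //.
by rewrite /limit_law setTI setIid.
Qed.

HB.instance Definition _ :=
  @Measure_isProbability.Build _ _ R limit_law limit_law_setT.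

(** Hides the probability structure on [limit_law], which depends on the proof of [c != 0], behind
    an existential. *)
Lemma limit_lawP : exists mu : probability R R, forall A, mu A = limit_law A.
Proof. by exists limit_law. Qed.

Lemma limit_law_cdf x :
  limit_law `]-oo, x] =
  (if x <= 0 then 0 else if x <= 1 then limit_cdf c x else 1)%:E.
Proof.
have [x0|x0] := leP x 0.
  rewrite /limit_law (_ : _ `&` _ = set0) ?integral_set0//.
  apply/seteqP; split => // y [] /=; rewrite !in_itv/= => yx /andP[y0 _].
  by have := le_lt_trans (le_trans yx x0) y0; rewrite ltxx.
have [x1|x1] := leP x 1.
  rewrite -limit_law_oc ?x0// /limit_law; congr (integral _ _ _).
  apply/seteqP; split => y [] /=; rewrite !in_itv/=.
    by move=> yx /andP[y0 y1]; rewrite y0 yx.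
  by move=> /andP[y0 yx] /andP[_ y1]; rewrite y0 yx.
rewrite -limit_law_setT /limit_law setTI setIidr// => y /=.
by rewrite !in_itv/= => /andP[_ y1]; rewrite (le_trans y1)// ltW.
Qed.

End limit_law_measure.

(** * Distribution function of the scaled first coordinate *)

Section first_coordinate_cdf.
Context {R : realType} (n : nat) (q : {posnum R}).

Let X : {RV (parking_mallows n.+1 q) >-> R} := scaled_parking_fst R n.

Let cdfE (x : R) :
  cdf X x = parking_mallows n.+1 q [set p | scaled_parking_fst R n p <= x].
Proof. by []. Qed.

Lemma cdf_scaled_parking_fst_lt0 (x : R) : x < 0 -> cdf X x = 0%E.
Proof.
move=> x0; rewrite cdfE (_ : [set _ | _] = set0) ?measure0//.
apply/seteqP; split => // p /= px.
have : 0 <= scaled_parking_fst R n p by rewrite divr_ge0.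
by rewrite leNgt (le_lt_trans px x0).
Qed.

Lemma cdf_scaled_parking_fst_ge1 (x : R) : 1 <= x -> cdf X x = 1%E.
Proof.
move=> x1; rewrite cdfE (_ : [set _ | _] = setT) ?probability_setT//.
apply/seteqP; split => // p _ /=; apply: le_trans x1.
rewrite ler_pdivrMr ?ltr0n// mul1r ler_nat.
by have /andP[/forallP/(_ ord0)/andP[]] := valP p.
Qed.

(** The first coordinate is an integer, so it is at most [x * n.+1] exactly when it is at most the
    integer part. *)
Lemma cdf_scaled_parking_fst (x : R) : 0 <= x ->
  cdf X x = (n.+1%:R^-1 * \sum_(j < n.+1)
    qnum q%:num (minn (Num.truncn (x * n.+1%:R)) j.+1) / qnum q%:num j.+1)%:E.
Proof.
move=> x0; rewrite -parking_mallows_fst_le cdfE.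
congr (parking_mallows _ _ _); apply/seteqP; split => p /=;
  by rewrite /scaled_parking_fst ler_pdivrMr ?ltr0n// truncn_ge_nat// mulr_ge0.
Qed.

End first_coordinate_cdf.

Theorem theorem2 (R : realType) (c : R) (c_neq0 : c != 0)
    (q : nat -> {posnum R})
    (qE : forall n : nat, `|c| < n.+1%:R -> (q n)%:num = 1 + c / n.+1%:R) :
  exists mu : probability R R,
    [/\ cvg_in_distribution
          (P := fun n : nat => parking_mallows n.+1 (q n))
          (fun n : nat => scaled_parking_fst R n) mu,
        mu `[0, 1]%classic = 1%E,
        [/\ forall x : R, x \in `[0, 1] ->
              mu `]-oo, x]%classic = (limit_cdf c x)%:E,
            limit_cdf c 0 = 0 &
            limit_cdf c x @[x --> 0^'+] --> 0],
        forall A : set R, measurable A ->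
          mu A = (\int[lebesgue_measure]_(x in A `&` `]0%R, 1%R])
                    (limit_density c x)%:E)%E &
        {in `]0, 1] &, forall x y : R,
          x < y -> limit_density c y < limit_density c x}].
Proof.
have [mu muE] := limit_lawP c_neq0; exists mu; split.
- move=> x _; rewrite muE limit_law_cdf//.
  have [x0|x0] := leP x 0.
    apply: cvg_near_cst; apply: nearW => n.
    (* At [x = 0] the truncation is 0 and every numerator is the empty sum [0] = 0. *)
    move: x0; rewrite le_eqVlt => /predU1P[->|]; last exact: cdf_scaled_parking_fst_lt0.
    rewrite cdf_scaled_parking_fst// mul0r truncn0 big1 ?mulr0// => j _.
    by rewrite min0n /qnum big_ord0 mul0r.
  have [x1|x1] := leP x 1.
    under eq_fun do rewrite (cdf_scaled_parking_fst _ _ (ltW x0)).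
    apply: cvg_EFin; first exact: nearW.
    by apply: cvg_mean_qnum_ratio => //; rewrite x0.
  by apply: cvg_near_cst; apply: nearW => n; exact/cdf_scaled_parking_fst_ge1/ltW.
(* [[0, 1]] and []-oo, 1]] have the same intersection with []0, 1]]. *)
- rewrite muE; apply: eq_trans (_ : limit_law c `]-oo, 1] = _).
    rewrite /limit_law; congr (integral _ _ _); apply/seteqP.
    split => y [] /=; rewrite !in_itv/=.
      by move=> /andP[_ ->].
    by move=> y1 /andP[y0 _]; rewrite (ltW y0) y1 y0.
  by rewrite limit_law_cdf// lexx leNgt ltr01/= limit_cdf1.
- split.
  + move=> x; rewrite in_itv/= muE limit_law_cdf// => /andP[x0 ->].
    (* Only [x = 0] falls into the branch with value 0, where it agrees with [limit_cdf0]. *)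
    case: leP => // x0'; rewrite (_ : x = 0) ?limit_cdf0//.
    by apply/eqP; rewrite eq_le x0' x0.
  + exact: limit_cdf0.
  + exact: limit_cdf_cvg0.
- by move=> A _; rewrite muE.
- exact: limit_density_decreasing.
Qed.
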